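(* Let $X$ be a nonempty finite set (the set of feasible solutions of a constraint satisfaction problem) whose cardinality $n$ is unknown to the algorithm, and let $\epsilon \in (0, 1/\mathrm{e})$. Suppose a sampler is available that returns independent samples, each uniformly distributed on $X$. Run Algorithm 1 (defined in the context) with this sampler and tolerance $\epsilon$. Then, regardless of the value of $n$, Algorithm 1 returns exactly the set $X$ (i.e., enumerates all feasible solutions) with probability greater than $1-\epsilon$.
   Context: Define $\alpha \coloneqq \ln(1/\epsilon) - 1$, $\beta \coloneqq \frac{\frac{1}{\mathrm{e}} + \frac{1}{3}\ln\frac{1}{3}}{\frac{1}{\mathrm{e}} - \frac{1}{3}}\,\alpha$, and \[ \kappa_1 \coloneqq \frac{3^{-2\alpha}}{1-\mathrm{e}^{-\beta}} + \frac{1}{1-\mathrm{e}^{-\frac{\alpha}{\mathrm{e}-1}}}. \] Algorithm 1: Draw one sample $x$; set $S=\{x\}$ and sample count $\tau=1$. For $m=2,3,\dots$: keep drawing samples (incrementing $\tau$ by one for each and adding the sampled element to $S$) until $\tau = \lceil m\ln(m\kappa_1/\epsilon)\rceil$; at that moment, if $|S|<m$, stop and return $S$; otherwise proceed to the next $m$. (Equivalently, the algorithm fails to return all of $X$ if and only if, for some $m\in\{2,\dots,n\}$, the number of samples needed to collect $m$ distinct elements exceeds $\lceil m\ln(m\kappa_1/\epsilon)\rceil$.) *)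

(* Defs.v *)
From HB Require Import structures.
From mathcomp Require Import all_boot all_order all_algebra finmap.
From mathcomp Require Import all_classical all_reals all_analysis.

Set Implicit Arguments.
Unset Strict Implicit.
Unset Printing Implicit Defensive.

Import Order.TTheory GRing.Theory Num.Theory.

Local Open Scope classical_set_scope.
Local Open Scope ring_scope.

Definition alpha (R : realType) (eps : R) : R := ln (1 / eps) - 1.

Definition beta (R : realType) (eps : R) : R :=
  (1 / expR 1 + 1 / 3 * ln (1 / 3)) / (1 / expR 1 - 1 / 3) * alpha eps.

Definition kappa1 (R : realType) (eps : R) : R :=
  3 `^ (- 2 * alpha eps) / (1 - expR (- beta eps))
  + 1 / (1 - expR (- (alpha eps / (expR 1 - 1)))).

Definition threshold (R : realType) (eps : R) (m : nat) : int :=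
  Num.ceil (m%:R * ln (m%:R * kappa1 eps / eps)).

(* Big-step semantics of the loop on a fixed stream of samples [s]:
   [loop_returns eps s m tau S A] says that the algorithm, being in iteration
   [m] with sample count [tau] and collected set [S], eventually stops and
   returns [A].  The samples drawn so far are s 0, ..., s (tau - 1), so the
   next one drawn is [s tau]. *)
Inductive loop_returns (R : realType) (X : finType) (eps : R) (s : nat -> X) :
    nat -> nat -> {set X} -> {set X} -> Prop :=
| LoopDraw m tau (S A : {set X}) :
    Posz tau <> threshold eps m ->
    loop_returns eps s m tau.+1 (s tau |: S)%SET A ->
    loop_returns eps s m tau S A
| LoopStop m tau (S : {set X}) :
    Posz tau = threshold eps m ->
    (#|S| < m)%N ->
    loop_returns eps s m tau S S
| LoopNext m tau (S A : {set X}) :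
    Posz tau = threshold eps m ->
    (m <= #|S|)%N ->
    loop_returns eps s m.+1 tau S A ->
    loop_returns eps s m tau S A.

Definition algorithm_returns (R : realType) (X : finType) (eps : R)
    (s : nat -> X) (A : {set X}) : Prop :=
  loop_returns eps s 2 1 [set s 0%N]%SET A.

(* [X] carries the discrete sigma-algebra. *)
Definition random_elements (d : measure_display) (T : measurableType d)
    (X : finType) (xi : nat -> T -> X) : Prop :=
  forall (i : nat) (B : set X), measurable (xi i @^-1` B).

Definition uniformly_distributed (R : realType) (d : measure_display)
    (T : measurableType d) (P : probability T R) (X : finType)
    (xi : nat -> T -> X) : Prop :=
  forall (i : nat) (x : X), P (xi i @^-1` [set x]) = ((#|X|%:R)^-1)%:E.

Definition mutually_independent (R : realType) (d : measure_display)
    (T : measurableType d) (P : probability T R) (X : finType)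
    (xi : nat -> T -> X) : Prop :=
  forall (J : {fset nat}) (B : nat -> set X),
    P (\bigcap_(j in [set` J]) (xi j @^-1` B j))
    = (\prod_(j <- J) P (xi j @^-1` B j))%E.

(* Main.v *)
Require Import Defs.
From HB Require Import structures.
From mathcomp Require Import all_boot all_order all_algebra finmap.
From mathcomp Require Import all_classical all_reals all_analysis.
From mathcomp Require Import ring lra zify.

Import Order.TTheory GRing.Theory Num.Theory.

Local Open Scope classical_set_scope.
Local Open Scope ring_scope.

(** Write [n = #|X|] and let [t_m] be the [m]-th threshold. The run enumerates
    [X] iff at least [m] distinct elements occur among the first [t_m] samples
    for every [2 <= m <= n]. If this fails at [m], some set of [m - 1] elements
    contains the first [t_m] samples, which has probability at most
    [C(n, m-1) ((m-1)/n)^t_m]. The bounds [1 - 1/m <= exp(-1/m)] and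
    [C(n, m-1) <= m (n/m)^(m (1 + ln m))] reduce this to
    [eps/kappa1 * exp(alpha m ln(m/n))]. Finally convexity of [x ln x], on
    [1/e, 1] and to the left of [1/e] respectively, dominates the exponentials
    by the two geometric series whose limits make up [kappa1], so that the sum
    over [m] is less than [eps]. *)

(** * Elementary estimates for logarithms and binomial coefficients *)

Section RealInequalities.
Context {R : realType}.
Implicit Types a b x : R.

Lemma ln_le_sub1 x : 0 < x -> ln x <= x - 1.
Proof.
by move=> x0; rewrite -{1}(subrKC 1 x); apply: le_ln1Dx; lra.
Qed.

Lemma ln_lt_sub1 x : 0 < x -> x != 1 -> ln x < x - 1.
Proof.
move=> x0 x1; have lnx0 : ln x != 0 by rewrite ln_eq0.
by have := expR_gt1Dx lnx0; rewrite lnK ?posrE//; lra.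
Qed.

(** The sixth power of [1 - 1/6 <= exp(-1/6)] suffices, because [(5/6)^6 > 1/3]; the lower bound on
    [e] uses [(7/6)^6 > 5/2] in the same way. *)
Lemma expR1_lt3 : expR 1 < 3 :> R.
Proof.
have h : 1 - 6^-1 <= expR (- 6^-1) :> R by exact: expR_ge1Dx.
have h6 : (1 - 6^-1) ^+ 6 <= expR (- 1) :> R.
  have -> : - 1 = 6%:R * (- 6^-1) :> R by field.
  by rewrite expRM_natl lerXn2r// nnegrE ?expR_ge0//; lra.
have h3 : 3^-1 < expR (- 1) :> R by apply: lt_le_trans h6; lra.
by move: h3; rewrite expRN ltf_pV2 ?posrE ?expR_gt0.
Qed.

Lemma expR1_gt5half : 5 / 2 < expR 1 :> R.
Proof.
have h : 1 + 6^-1 <= expR (6^-1) :> R by exact: expR_ge1Dx.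
have h6 : (1 + 6^-1) ^+ 6 <= expR 1 :> R.
  have -> : 1 = 6%:R * 6^-1 :> R by field.
  by rewrite expRM_natl lerXn2r ?nnegrE ?expR_ge0//; lra.
by apply: lt_le_trans h6; lra.
Qed.

(** Convexity without derivatives: [c ln x <= c ln c + (x - c)], taken at [c = a] and [c = b] with
    weights [b - x] and [x - a], has error terms that cancel. *)
Lemma xlnx_chord a b x : 0 < a -> a <= x <= b ->
  (b - a) * (x * ln x) <= (b - x) * (a * ln a) + (x - a) * (b * ln b).
Proof.
move=> a0 /andP[ax xb]; have x0 : 0 < x by lra.
have tangent (c : R) : 0 < c -> c * ln x <= c * ln c + (x - c).
  move=> c0; have := ln_le_sub1 _ (divr_gt0 x0 c0).
  rewrite ln_div ?posrE// => /(ler_wpM2l (ltW c0)).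
  have -> : c * (x / c - 1) = x - c by field; rewrite gt_eqF.
  by lra.
have b0 : 0 < b by lra.
have ha : (b - x) * (a * ln x) <= (b - x) * (a * ln a + (x - a)).
  by apply: ler_wpM2l; [lra|exact: tangent].
have hb : (x - a) * (b * ln x) <= (x - a) * (b * ln b + (x - b)).
  by apply: ler_wpM2l; [lra|exact: tangent].
by move: (lerD ha hb); lra.
Qed.

Lemma ln_chord a b x : 0 < a -> a <= x <= b ->
  (b - x) * ln a + (x - a) * ln b <= (b - a) * ln x.
Proof.
move=> a0 /andP[ax xb]; have x0 : 0 < x by lra.
have tangent (c : R) : 0 < c -> ln c <= ln x + (c / x - 1).
  move=> c0; have := ln_le_sub1 _ (divr_gt0 c0 x0).
  by rewrite ln_div ?posrE//; lra.
have b0 : 0 < b by lra.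
have ha : (b - x) * ln a <= (b - x) * (ln x + (a / x - 1)).
  by apply: ler_wpM2l; [lra|exact: tangent].
have hb : (x - a) * ln b <= (x - a) * (ln x + (b / x - 1)).
  by apply: ler_wpM2l; [lra|exact: tangent].
have e : (b - x) * (a / x - 1) + (x - a) * (b / x - 1) = 0.
  by field; rewrite gt_eqF.
by move: (lerD ha hb) e; lra.
Qed.

(** The left side is the logarithm of [C(N, M-1) / C(N-1, M-1)]. Concavity of [ln] bounds it by
    [(M+1) ln((M+1)/2) / N], while the last factor on the right is at least [1/N]. *)
Lemma ln_ratio_step (M N : R) : 2 <= M -> M + 1 <= N ->
  ln N - ln (N - M + 1) <= M * (1 + ln M) * (ln N - ln (N - 1)).
Proof.
move=> M2 MN; have N0 : 0 < N by lra.
have lnM0 : 0 <= ln M by apply: ln_ge0; lra.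
have MN0 : 0 < M * (1 + ln M) by apply: mulr_gt0; lra.
have h1 : N^-1 <= ln N - ln (N - 1).
  have Nm0 : 0 < N - 1 by lra.
  have := ln_le_sub1 _ (divr_gt0 Nm0 N0).
  rewrite ln_div ?posrE//.
  have -> : (N - 1) / N - 1 = - N^-1 by field; rewrite gt_eqF.
  by lra.
apply: le_trans (_ : _ <= M * (1 + ln M) * N^-1) _; last first.
  by rewrite ler_pM2l.
(* Combines [ln(M+1) <= ln M + 1/M], [ln(M+1) <= M] and [ln 2 >= 1/2]. *)
have h2 : (M + 1) * ln ((M + 1) / 2) <= M * (1 + ln M).
  have M0 : 0 < M by lra.
  have M10 : 0 < M + 1 by lra.
  have := ln_le_sub1 _ (divr_gt0 M10 M0).
  have := ln_le_sub1 _ M10.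
  have := ln_le_sub1 (2^-1) ltac:(by lra).
  rewrite !ln_div ?posrE// lnV ?posrE// => l2 lM /(ler_wpM2l (ltW M0)).
  have -> : M * ((M + 1) / M - 1) = 1 by field; rewrite gt_eqF.
  have : (M + 1) * (- ln 2) <= (M + 1) * (- 2^-1).
    by apply: ler_wpM2l; lra.
  by lra.
have x0 : 0 < N - M + 1 by lra.
have aM0 : 0 < M + 1 by lra.
(* The chord starts at [2/(M+1)], the value of [(N-M+1)/N] in the extreme case [N = M + 1]. *)
have a0 : 0 < 2 / (M + 1) by apply: divr_gt0.
have ax1 : 2 / (M + 1) <= (N - M + 1) / N <= 1.
  rewrite [_ <= 1]ler_pdivrMr// mul1r ler_pdivrMr//.
  rewrite mulrAC ler_pdivlMr//; apply/andP; split; nra.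
have := ln_chord _ _ _ a0 ax1.
rewrite ln1 mulr0 addr0 !ln_div ?posrE//.
have -> : 1 - (N - M + 1) / N = (M - 1) / N by field; rewrite gt_eqF.
have -> : 1 - 2 / (M + 1) = (M - 1) / (M + 1) by field; rewrite gt_eqF.
move=> h3.
have c0 : 0 < (M + 1) / (M - 1) by apply: divr_gt0; lra.
have M1 : M - 1 != 0 by rewrite gt_eqF; lra.
move: h3 => /(ler_wpM2l (ltW c0)).
have -> : (M + 1) / (M - 1) * ((M - 1) / N * (ln 2 - ln (M + 1))) =
  - ((M + 1) * (ln (M + 1) - ln 2) / N).
  by field; rewrite gt_eqF//= M1.
have -> : (M + 1) / (M - 1) * ((M - 1) / (M + 1) * (ln (N - M + 1) - ln N)) =
  ln (N - M + 1) - ln N.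
  by field; rewrite gt_eqF//= M1.
move=> h3.
have : (M + 1) * (ln (M + 1) - ln 2) / N <= M * (1 + ln M) / N.
  by rewrite ler_pM2r ?invr_gt0// -ln_div ?posrE.
by lra.
Qed.

(* Induction on [n]: at [n = m] equality holds, and the step compares the ratios
   of consecutive values of the two sides, which is [ln_ratio_step]. *)
Lemma bin_le_expR (m n : nat) : (2 <= m <= n)%N ->
  'C(n, m.-1)%:R <=
    m%:R * expR (m%:R * (1 + ln m%:R) * (ln n%:R - ln m%:R)) :> R.
Proof.
case/andP=> m2 /subnKC <-; elim: (n - m)%N => [|k IH].
  rewrite addn0 subrr mulr0 expR0 mulr1.
  by rewrite -{1}(prednK (ltnW m2)) binSn prednK// ltnW.
rewrite addnS; set p := (m + k)%N in IH *.
have m0 : 0 < m%:R :> R by rewrite ltr0n ltnW.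
have M2 : 2 <= m%:R :> R by rewrite ler_nat.
have pm : m%:R <= p%:R :> R by rewrite ler_nat leq_addr.
have NE : (p.+1)%:R = p%:R + 1 :> R by rewrite -natr1.
have x0 : 0 < p%:R + 1 - m%:R + 1 :> R by lra.
have e : p.+1%:R * 'C(p, m.-1)%:R =
    (p%:R + 1 - m%:R + 1) * 'C(p.+1, m.-1)%:R :> R.
  rewrite -natrM (mul_bin_down p.+1) natrM; congr (_ * _).
  rewrite natrB; last by lia.
  rewrite NE -{2}(prednK (ltnW m2)) -natr1; ring.
have -> : 'C(p.+1, m.-1)%:R =
    expR (ln (p%:R + 1) - ln (p%:R + 1 - m%:R + 1)) * 'C(p, m.-1)%:R :> R.
  rewrite expRB !lnK ?posrE//.
  by apply: (mulfI (lt0r_neq0 x0)); rewrite -e NE; field; rewrite gt_eqF.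
apply: le_trans (ler_wpM2l (expR_ge0 _) IH) _.
rewrite mulrCA ler_pM2l// -expRD ler_expR NE.
have := ln_ratio_step m%:R (p%:R + 1) M2 ltac:(by lra).
by rewrite addrK; lra.
Qed.

(** With [L = ln n - ln m], the power is at most [exp(-t (L + 1/m))]. The lower bound on [t] makes
    the [L] part cancel the binomial exponent and leave [alpha], while the [1/m] part yields
    [eps / (kappa m)]. *)
Lemma bin_mulXn_le_expR (m n t : nat) (eps kappa : R) :
  0 < eps -> 1 <= kappa -> (2 <= m <= n)%N ->
  0 <= alpha eps ->
  m%:R * ln (m%:R * kappa / eps) <= t%:R ->
  'C(n, m.-1)%:R * (m.-1%:R / n%:R) ^+ t <=
    eps / kappa * expR (alpha eps * (m%:R * (ln m%:R - ln n%:R))).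
Proof.
move=> eps0 kappa1 mn al0 mt.
have m2 : (2 <= m)%N by case/andP: mn.
have m0 : 0 < m%:R :> R by rewrite ltr0n ltnW.
have nm : m%:R <= n%:R :> R by rewrite ler_nat; case/andP: mn.
have n0 : 0 < n%:R :> R by lra.
have k0 : 0 < kappa by lra.
have L0 : 0 <= ln n%:R - ln m%:R :> R by rewrite subr_ge0 ler_ln.
have lnk : 0 <= ln kappa by exact: ln_ge0.
have M1 : m.-1%:R = m%:R - 1 :> R.
  by rewrite -{2}(prednK (ltnW m2)) -natr1 addrK.
have lne : ln eps = - (1 + alpha eps).
  by rewrite /alpha div1r lnV ?posrE//; ring.
(* Factor [(m-1)/n] as [(m/n) (1 - 1/m)]. *)
have base : m.-1%:R / n%:R <= expR (- (ln n%:R - ln m%:R + m%:R^-1)) :> R.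
  have -> : - (ln n%:R - ln m%:R + m%:R^-1) = ln m%:R - ln n%:R + - m%:R^-1 :> R.
    by ring.
  rewrite expRD expRB !lnK ?posrE//.
  apply: le_trans (ler_wpM2l _ (expR_ge1Dx _)); last by rewrite divr_ge0// ltW.
  by rewrite M1 le_eqVlt; apply/orP; left; apply/eqP; field; rewrite !gt_eqF.
have pw : (m.-1%:R / n%:R) ^+ t <=
    expR (- (t%:R * (ln n%:R - ln m%:R + m%:R^-1))) :> R.
  by rewrite -mulrN expRM_natl lerXn2r ?nnegrE ?expR_ge0//.
apply: le_trans (ler_pM _ _ (bin_le_expR _ _ mn) pw) _; rewrite ?ler0n//.
have -> : eps / kappa = m%:R * expR (ln eps - ln kappa - ln m%:R).
  by rewrite !expRB !lnK ?posrE//; field; rewrite !gt_eqF.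
rewrite -!mulrA ler_pM2l// -!expRD ler_expR.
have W0 : 0 <= ln n%:R - ln m%:R + m%:R^-1 :> R.
  by rewrite addr_ge0// invr_ge0 ltW.
have := ler_wpM2r W0 mt.
rewrite ln_div ?posrE ?mulr_gt0// lnM ?posrE// lne.
move: (ln m%:R) (ln n%:R) (ln kappa) (alpha eps) L0 lnk {lne W0 mt} al0.
move=> lm ln lk al L0 lk0 al0.
have -> : m%:R * (lm + lk - - (1 + al)) * (ln - lm + m%:R^-1) =
  m%:R * (lm + lk + 1 + al) * (ln - lm) + (lm + lk + 1 + al) :> R.
  by field; rewrite gt_eqF.
have : 0 <= m%:R * lk * (ln - lm) by rewrite !mulr_ge0// ltW.
by lra.
Qed.

End RealInequalities.

(** * The constants [beta] and [kappa1], the two geometric series, and the thresholds *)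

Section Kappa.
Context {R : realType} (eps : R).
Hypothesis eps_range : 0 < eps < 1 / expR 1.

Let eps0 : 0 < eps. Proof. by case/andP: eps_range. Qed.

Lemma alpha_gt0 : 0 < alpha eps.
Proof.
have h : expR 1 < 1 / eps.
  by rewrite ltr_pdivlMr// mulrC -ltr_pdivlMr ?expR_gt0//; case/andP: eps_range.
rewrite /alpha subr_gt0 -{1}(expRK 1) ltr_ln// posrE ?expR_gt0//.
by rewrite divr_gt0.
Qed.

(** Minus the slope of the chord of [x ln x] between [1/3] and [1/e]. *)
Definition beta_slope : R :=
  (1 / expR 1 + 1 / 3 * ln (1 / 3)) / (1 / expR 1 - 1 / 3).

Lemma ln_invr_expR1 : ln (1 / expR 1) = - 1 :> R.
Proof. by rewrite div1r -expRN expRK. Qed.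

Lemma invr3_lt_invr_expR1 : 1 / 3 < 1 / expR 1 :> R.
Proof. by rewrite !div1r ltf_pV2 ?posrE ?expR_gt0// expR1_lt3. Qed.

(** Up to a factor 3, positivity of the numerator is [ln(3/e) < 3/e - 1], strict because [e < 3]. *)
Lemma beta_gt0 : 0 < beta eps.
Proof.
apply: mulr_gt0 alpha_gt0; have e0 := expR_gt0 (1 : R).
apply: divr_gt0; last by rewrite subr_gt0 invr3_lt_invr_expR1.
have e3 := expR1_lt3 (R := R).
have h : ln (3 / expR 1) < 3 / expR 1 - 1 :> R.
  apply: ln_lt_sub1; first by rewrite divr_gt0.
  by rewrite gt_eqF// ltr_pdivlMr// mul1r.
move: h; rewrite ln_div ?posrE// expRK !div1r lnV ?posrE//; lra.
Qed.

Lemma expRN_beta_lt1 : expR (- beta eps) < 1.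
Proof. by rewrite expR_lt1 oppr_lt0 beta_gt0. Qed.

Lemma expRN_alpha_lt1 : expR (- (alpha eps / (expR 1 - 1))) < 1.
Proof.
by rewrite expR_lt1 oppr_lt0 divr_gt0 ?alpha_gt0//.
Qed.

Lemma kappa1_ge1 : 1 <= kappa1 eps.
Proof.
rewrite -[leLHS]add0r; apply: lerD.
  by rewrite divr_ge0 ?powR_ge0// subr_ge0 ltW// expRN_beta_lt1.
have q1 := expRN_alpha_lt1.
by rewrite ler_pdivlMr ?subr_gt0// mul1r gerBl expR_ge0.
Qed.

(** At [x = m/n] in [[1/e, 1]], the chord of [x ln x] has slope [1/(e-1)] and vanishes at 1; scale
    by [n]. *)
Lemma xlnx_upper_range (m n : nat) : (0 < m <= n)%N ->
  n%:R <= m%:R * expR 1 :> R ->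
  m%:R * (ln m%:R - ln n%:R) <= - ((n - m)%:R / (expR 1 - 1)) :> R.
Proof.
case/andP=> m0 mn nme.
have M0 : 0 < m%:R :> R by rewrite ltr0n.
have MN : m%:R <= n%:R :> R by rewrite ler_nat.
have N0 : 0 < n%:R :> R by lra.
have e0 := expR_gt0 (1 : R).
have e1 : 0 < expR 1 - 1 :> R by have := expR1_gt5half (R := R); lra.
have a0 : 0 < 1 / expR 1 :> R by rewrite divr_gt0.
have ax : 1 / expR 1 <= (m%:R / n%:R : R) <= 1.
  apply/andP; split; last by rewrite ler_pdivrMr// mul1r.
  by rewrite ler_pdivlMr// mulrAC mul1r ler_pdivrMr.
have := xlnx_chord _ _ _ a0 ax.
rewrite ln1 !mulr0 addr0 ln_invr_expR1 ln_div ?posrE//.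
have c0 : 0 <= n%:R * expR 1 / (expR 1 - 1) :> R.
  by rewrite divr_ge0 ?mulr_ge0// ltW.
move=> /(ler_wpM2l c0).
congr (_ <= _); first by field; rewrite !gt_eqF.
by rewrite natrB//; field; rewrite !gt_eqF.
Qed.

(* Since [2 e > 5], the hypotheses force [n >= 6]; by convexity the chord of
   [x ln x] from [2/n] to [1/e] is then at least as steep as the one from [1/3]. *)
Lemma xlnx_lower_range (m n : nat) : (2 <= m)%N ->
  m%:R * expR 1 < n%:R :> R ->
  m%:R * (ln m%:R - ln n%:R) <= - (2 * ln 3) - (m - 2)%:R * beta_slope :> R.
Proof.
move=> m2 nme.
have M2 : 2 <= m%:R :> R by rewrite ler_nat.
have M0 : 0 < m%:R :> R by lra.
have e0 := expR_gt0 (1 : R).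
have e52 := expR1_gt5half (R := R).
have N6 : 6 <= n%:R :> R.
  rewrite ler_nat -(ltr_nat R); apply: le_lt_trans nme.
  apply: le_trans (_ : 2 * expR 1 <= _); first by lra.
  by rewrite ler_pM2r.
have N0 : 0 < n%:R :> R by lra.
set b := 1 / expR 1 : R; set u := 2 / n%:R : R; set x := m%:R / n%:R : R.
have u0 : 0 < u by rewrite divr_gt0.
have u3 : u <= 1 / 3 by rewrite ler_pdivrMr//; lra.
have b3 : 1 / 3 < b := invr3_lt_invr_expR1.
have ux : u <= x by rewrite ler_pM2r// invr_gt0.
have xb : x <= b.
  by rewrite ler_pdivrMr// mulrAC mul1r ler_pdivlMr// ltW.
have /(xlnx_chord _ _ _ u0) : u <= x <= b by rewrite ux.
have /(xlnx_chord _ _ _ u0) : u <= 1 / 3 <= b by rewrite u3 ltW.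
rewrite !ln_invr_expR1 -/b.
(* Scaled by [n], this becomes [2 ln 3], the source of [3^(-2 alpha)] in [kappa1]. *)
have lnu : u * ln u <= - u * ln 3.
  rewrite mulNr -mulrN -lnV ?posrE// ler_pM2l// ler_ln ?posrE//.
  by rewrite -div1r.
move=> h3 hx.
have slope : b - u != 0 by rewrite gt_eqF//; lra.
have bu : 0 < b - u by lra.
have cE : beta_slope * (b - 1 / 3) = b + 1 / 3 * ln (1 / 3).
  by rewrite /beta_slope -/b divfK// gt_eqF//; lra.
have hs : (b - u) * beta_slope <= b + u * ln u.
  have b30 : 0 < b - 1 / 3 by lra.
  rewrite -(ler_pM2r b30) -mulrA cE; move: h3; lra.
have hf : x * ln x <= u * ln u - (x - u) * beta_slope.
  rewrite -(ler_pM2l bu); apply: le_trans hx _.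
  have xu : 0 <= x - u by lra.
  have := ler_wpM2l xu hs; lra.
have : x * ln x <= - u * ln 3 - (x - u) * beta_slope by lra.
rewrite ln_div ?posrE// => /(ler_wpM2l (ltW N0)).
congr (_ <= _); first by rewrite /x; field; rewrite gt_eqF.
by rewrite natrB// /x /u; field; rewrite gt_eqF.
Qed.

Lemma sum_geometric_lt (q : R) (k : nat) : 0 < q < 1 ->
  \sum_(i < k) q ^+ i < (1 - q)^-1.
Proof.
case/andP=> q0 q1; have q10 : 0 < 1 - q by lra.
rewrite -(ltr_pM2l q10) mulfV ?gt_eqF//.
have := subrX1 q k; have := exprn_gt0 k q0; lra.
Qed.

Lemma sum_expR_lt_kappa1 (n : nat) :
  \sum_(2 <= m < n.+1) expR (alpha eps * (m%:R * (ln m%:R - ln n%:R)))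
    < kappa1 eps.
Proof.
set q := expR (- (alpha eps / (expR 1 - 1))).
set r := expR (- beta eps).
have al0 := alpha_gt0.
have q01 : 0 < q < 1 by rewrite expR_gt0 expRN_alpha_lt1.
have r01 : 0 < r < 1 by rewrite expR_gt0 expRN_beta_lt1.
set A := 3 `^ (- 2 * alpha eps).
have A0 : 0 < A by rewrite powR_gt0.
(* Both summands on the right are nonnegative, so one bound serves on either side of [n = m e] and
   the sum need not be split. *)
have term m : (2 <= m < n.+1)%N ->
    expR (alpha eps * (m%:R * (ln m%:R - ln n%:R))) <=
      A * r ^+ (m - 2) + q ^+ (n - m).
  move=> /andP[m2 mn].
  have [nme|nme] := leP n%:R (m%:R * expR 1 : R).
  - rewrite -[leLHS]add0r; apply: lerD.
      by rewrite mulr_ge0 ?exprn_ge0 ?ltW//; case/andP: r01.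
    rewrite /q -expRM_natl ler_expR.
    have h : (0 < m <= n)%N by lia.
    have := ler_wpM2l (ltW al0) (xlnx_upper_range _ _ h nme); lra.
  - rewrite -[leLHS]addr0; apply: lerD; last first.
      by rewrite exprn_ge0 ?ltW//; case/andP: q01.
    rewrite /r -expRM_natl /A /powR (_ : 3 == 0 = false)//; last first.
      by rewrite pnatr_eq0.
    rewrite -expRD ler_expR /beta -/beta_slope.
    have := ler_wpM2l (ltW al0) (xlnx_lower_range _ _ m2 nme); lra.
apply: le_lt_trans (ler_sum_nat term) _.
rewrite big_split /= -mulr_sumr /kappa1 -/A -/q -/r div1r; apply: ltrD.
  rewrite ltr_pM2l// -{1}[2%N]add0n big_addn (eq_bigr (fun i => r ^+ i)); last first.
    by move=> i _; rewrite addnK.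
  by rewrite big_mkord sum_geometric_lt.
apply: le_lt_trans (sum_geometric_lt _ n.+1 q01).
have q_ge0 i : 0 <= q ^+ i by rewrite exprn_ge0// ltW//; case/andP: q01.
have [n1|n2] := leqP n.+1 2.
  by rewrite big_geq//; apply: sumr_ge0.
(* Reversal gives the exponents [n - m] for [m] from 0 to [n]; the terms with [m < 2] only add to
   the bound. *)
rewrite (reindex_inj rev_ord_inj) /=.
rewrite -(big_mkord xpredT (fun i => q ^+ (n.+1 - i.+1))).
rewrite [leRHS](@big_cat_nat _ _ _ 2)//=; last exact: ltnW.
by rewrite lerDr sumr_ge0.
Qed.

Lemma kappa1_div_gt1 : 1 < kappa1 eps / eps.
Proof.
have k1 := kappa1_ge1; have e52 := expR1_gt5half (R := R).
have e1 : eps < 1.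
  case/andP: eps_range => _ /lt_le_trans; apply.
  by rewrite ler_pdivrMr ?expR_gt0// mul1r; lra.
by rewrite ltr_pdivlMr// mul1r; lra.
Qed.

(** Ensures that the sample count has not already passed the next threshold when an iteration
    ends. *)
Lemma threshold_homo (m p : nat) : (1 <= m <= p)%N ->
  threshold eps m <= threshold eps p.
Proof.
case/andP=> m1 mp; have ke := kappa1_div_gt1.
have M1 : 1 <= m%:R :> R by rewrite ler1n.
have MP : m%:R <= p%:R :> R by rewrite ler_nat.
rewrite /threshold -!mulrA; apply: le_ceil; apply: ler_pM => //.
  by apply: ln_ge0; nra.
have ke0 : 0 < kappa1 eps / eps by lra.
have pos (x : R) : 1 <= x -> x * (kappa1 eps / eps) \in Num.pos.
  by move=> x1; rewrite posrE mulr_gt0//; lra.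
by rewrite ler_ln ?pos ?ler_pM2r//; lra.
Qed.

Lemma threshold_gt0 (m : nat) : (1 <= m)%N -> 0 < threshold eps m.
Proof.
move=> m1; have ke := kappa1_div_gt1.
have M1 : 1 <= m%:R :> R by rewrite ler1n.
rewrite /threshold -mulrA ceil_gt0; apply: mulr_gt0; first by lra.
by apply: ln_gt0; nra.
Qed.

End Kappa.

(** * Runs of the loop in terms of sample prefixes *)

Section Loop.
Context {R : realType} {X : finType} (eps : R).
Hypothesis eps_range : 0 < eps < 1 / expR 1.
Implicit Types s : nat -> X.

Definition collected s (t : nat) : {set X} := [set s i | i : 'I_t]%SET.

(** The absolute value only changes the type: for [m >= 1] the threshold is positive. *)
Definition stop_time (m : nat) : nat := `|threshold eps m|%N.

Lemma collectedS s t : collected s t.+1 = (s t |: collected s t)%SET.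
Proof.
apply/setP => x; rewrite !inE; apply/imsetP/orP => [[i _ ->]|].
  have [it|it] := ltnP i t; last first.
    by left; rewrite (_ : nat_of_ord i = t)//; have := ltn_ord i; lia.
  by right; apply/imsetP; exists (Ordinal it).
case=> [/eqP ->|/imsetP[i _ ->]]; first by exists ord_max.
by exists (widen_ord (leqnSn t) i).
Qed.

Lemma collected1 s : collected s 1 = [set s 0%N]%SET.
Proof.
rewrite collectedS; apply/setP => x; rewrite !inE.
rewrite [x \in _](_ : _ = false) ?orbF//.
by apply/imsetP => -[[]].
Qed.

Lemma collected_homo s t u : (t <= u)%N -> collected s t \subset collected s u.
Proof.
move=> tu; apply/fintype.subsetP => x /imsetP[i _ ->].
by apply/imsetP; exists (widen_ord tu i).
Qed.

Lemma stop_timeE m : (1 <= m)%N -> Posz (stop_time m) = threshold eps m.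
Proof. by move=> m1; rewrite gez0_abs// ltW// threshold_gt0. Qed.

Lemma stop_time_gt0 m : (1 <= m)%N -> (0 < stop_time m)%N.
Proof. by move=> m1; rewrite -ltz_nat stop_timeE// threshold_gt0. Qed.

Lemma stop_time_homo m p : (1 <= m <= p)%N -> (stop_time m <= stop_time p)%N.
Proof.
move=> mp; rewrite -lez_nat !stop_timeE ?threshold_homo//; lia.
Qed.

(** Induction on the derivation. Each [LoopNext] gives the claim for its own [m], and stopping with
    all of [X] forces [m > #|X|], so that no [k] remains. *)
Lemma loop_returns_complete s m tau S A :
  loop_returns eps s m tau S A -> S = collected s tau -> (1 <= m)%N ->
  A = [set: X]%SET ->
  forall k, (m <= k <= #|X|)%N -> (k <= #|collected s (stop_time k)|)%N.
Proof.
elim=> {}m {}tau {}S => [{}A _ _ IH|_ Sm|{}A E mS _ IH] ES m1 AT k.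
- by apply: IH; rewrite // ES collectedS.
- by move: Sm; rewrite AT cardsT; lia.
- rewrite leq_eqVlt => /andP[/orP[/eqP <-|mk] kn].
    by rewrite /stop_time -E /= -ES.
  by apply: IH; rewrite ?mk// ltnW.
Qed.

(** Nested inductions, on the iterations left and on the samples left before the current threshold;
    the loop must stop at [m = #|X| + 1]. *)
Lemma complete_loop_returns s m tau : (0 < #|X|)%N ->
  (forall k, (2 <= k <= #|X|)%N -> (k <= #|collected s (stop_time k)|)%N) ->
  (2 <= m <= #|X|.+1)%N -> (tau <= stop_time m)%N ->
  loop_returns eps s m tau (collected s tau) [set: X]%SET.
Proof.
move=> X0 H; have [p] := ubnP (#|X|.+1 - m)%N.
elim: p m tau => // p IHp m tau mp m2.
have m1 : (1 <= m)%N by lia.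
have [q] := ubnP (stop_time m - tau)%N.
elim: q tau => // q IHq tau tq tm.
have [Et|nt] := eqVneq tau (stop_time m); last first.
  apply: LoopDraw; first by rewrite -stop_timeE// => -[]; apply/eqP.
  by rewrite -collectedS; apply: IHq; lia.
have Ep : Posz tau = threshold eps m by rewrite Et stop_timeE.
have [mX|Xm] := leqP m #|X|.
  apply: LoopNext => //; first by rewrite Et; apply: H; lia.
  apply: IHp; [lia|lia|].
  by rewrite Et; apply: stop_time_homo; lia.
have mE : m = #|X|.+1 by lia.
have full : collected s tau = [set: X]%SET.
  apply/eqP; rewrite eqEcard finset.subsetT cardsT.
  (* For [#|X| <= 1] the hypothesis [H] is vacuous and the first sample fills [X]. *)
  have [X1|X2] := leqP #|X| 1.
    apply: leq_trans X1 _; rewrite card_gt0; apply/set0Pn; exists (s 0%N).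
    have t0 : (0 < tau)%N by rewrite Et stop_time_gt0.
    by apply/imsetP; exists (Ordinal t0).
  apply: leq_trans (H #|X| _) _; first by rewrite X2/=.
  by apply/subset_leq_card/collected_homo; rewrite Et stop_time_homo//; lia.
by rewrite full; apply: LoopStop; rewrite // cardsT mE.
Qed.

Lemma algorithm_returnsP s : (0 < #|X|)%N ->
  algorithm_returns eps s [set: X]%SET <->
  forall k, (2 <= k <= #|X|)%N -> (k <= #|collected s (stop_time k)|)%N.
Proof.
move=> X0; rewrite /algorithm_returns -collected1; split.
  by move=> H; apply: (loop_returns_complete _ _ _ _ _ H).
by move=> H; apply: complete_loop_returns; rewrite ?stop_time_gt0.
Qed.

End Loop.

(** * Probability of seeing few distinct elements *)

Section Probability.
Context {R : realType} {d : measure_display} {T : measurableType d}.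
Context (P : probability T R) {X : finType} (xi : nat -> T -> X).
Hypothesis xi_random : random_elements xi.
Hypothesis xi_uniform : uniformly_distributed P xi.
Hypothesis xi_independent : mutually_independent P xi.

(** Indexed by a finite set of naturals to match [mutually_independent]. *)
Definition all_in (t : nat) (A : {set X}) : set T :=
  \bigcap_(j in [set` [fset j in iota 0 t]%fset]) (xi j @^-1` [set` A]).

Definition fewer_than (t m : nat) : set T :=
  [set w | (#|collected (fun i => xi i w) t| < m)%N].

Lemma measurable_all_in t A : measurable (all_in t A).
Proof. by apply: bigcap_measurableType => j _; exact: xi_random. Qed.

Lemma uniform_setE i (A : {set X}) :
  P (xi i @^-1` [set` A]) = (#|A|%:R / #|X|%:R)%:E.
Proof.
have -> : xi i @^-1` [set` A] = \bigcup_(x in [set` enum A]) (xi i @^-1` [set x]).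
  apply/seteqP; split => w /=.
    by move=> wA; exists (xi i w) => //=; rewrite mem_enum.
  by move=> [x /=]; rewrite mem_enum => xA ->.
rewrite (measure_fin_bigcup P)//; last by move=> x y _ _ [w [/= <- <-]].
rewrite -fsbig_seq ?enum_uniq//= (eq_bigr (fun=> ((#|X|%:R)^-1)%:E)); last first.
  by move=> x _; exact: xi_uniform.
rewrite sumEFin big_enum/= sumr_const.
by rewrite mulr_natl.
Qed.

Lemma all_inE t A : P (all_in t A) = ((#|A|%:R / #|X|%:R) ^+ t)%:E.
Proof.
rewrite /all_in (xi_independent _ (fun=> [set` A])).
rewrite (eq_bigr (fun=> (#|A|%:R / #|X|%:R)%:E)); last first.
  by move=> j _; exact: uniform_setE.
rewrite prodEFin big_const_seq count_predT iter_mulr_1.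
by rewrite card_fseq undup_id ?iota_uniq// size_iota.
Qed.

Lemma all_inP t A w : all_in t A w <-> collected (fun i => xi i w) t \subset A.
Proof.
split.
  move=> H; apply/fintype.subsetP => x /imsetP[i _ ->].
  by apply: (H i); rewrite /= !inE mem_iota /=.
move=> /fintype.subsetP H j /=; rewrite !inE mem_iota /= add0n => jt.
by apply: H; apply/imsetP; exists (Ordinal jt).
Qed.

(** Padding to an exact size lets the union bound range over sets of size [m - 1] only, hence a
    single binomial coefficient. *)
Lemma exists_superset_card (S : {set X}) k : (#|S| <= k <= #|X|)%N ->
  exists2 A : {set X}, S \subset A & #|A| = k.
Proof.
case/andP=> Sk kX.
have : (k - #|S| <= #|(~: S)%SET|)%N by have := cardsC S; lia.
case/card_geqP => s [us ss sS].
exists (S :|: [set x in s])%SET; first exact: finset.subsetUl.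
rewrite cardsU disjoint_setI0 ?cards0 ?subn0; last first.
  rewrite finset.disjoints_subset; apply/fintype.subsetP => x xS.
  by rewrite !inE; apply/negP => /sS; rewrite inE xS.
by rewrite cardsE (card_uniqP us) ss; lia.
Qed.

Lemma fewer_thanE t m : (1 <= m <= #|X|)%N -> fewer_than t m =
  \bigcup_(A in [set` enum [set A : {set X} | #|A| == m.-1]%SET]) all_in t A.
Proof.
move=> m1; apply/seteqP; split => w.
  rewrite /fewer_than /= => Sm.
  have [|A SA Am] := exists_superset_card (collected (fun i => xi i w) t) m.-1.
    by lia.
  by exists A; [rewrite /= mem_enum inE Am|exact/all_inP].
move=> [A /=]; rewrite mem_enum inE => /eqP Am /all_inP /subset_leq_card.
by rewrite Am /fewer_than /=; lia.
Qed.

Lemma measurable_fewer_than t m : (1 <= m <= #|X|)%N ->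
  measurable (fewer_than t m).
Proof.
move=> m1; rewrite fewer_thanE//.
apply: fin_bigcup_measurable => [|A _]; first exact: finite_finset.
exact: measurable_all_in.
Qed.

Lemma fewer_than_le t m : (1 <= m <= #|X|)%N ->
  (P (fewer_than t m) <=
    ('C(#|X|, m.-1)%:R * (m.-1%:R / #|X|%:R) ^+ t)%:E)%E.
Proof.
move=> m1; set F := [set A : {set X} | #|A| == m.-1]%SET.
apply: le_trans.
  apply: (content_sub_fsum P (D := [set` enum F]) (A_ := all_in t)).
  - exact: finite_finset.
  - by move=> A _; exact: measurable_all_in.
  - exact: measurable_fewer_than.
  - by rewrite -fewer_thanE.
rewrite -fsbig_seq ?enum_uniq//= big_seq.
rewrite (eq_bigr (fun=> ((m.-1%:R / #|X|%:R) ^+ t)%:E)); last first.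
  by move=> A; rewrite mem_enum inE => /eqP <-; exact: all_inE.
rewrite -big_seq sumEFin big_enum/= sumr_const card_draws.
by rewrite (mulr_natl (_ ^+ t)).
Qed.

End Probability.

(** * Union bound over the iterations *)

Theorem theorem1 (R : realType) (d : measure_display) (T : measurableType d)
    (P : probability T R) (X : finType) (eps : R) (xi : nat -> T -> X)
    (X_nonempty : (0 < #|X|)%N)
    (eps_range : 0 < eps < 1 / expR 1)
    (xi_random : random_elements xi)
    (xi_uniform : uniformly_distributed P xi)
    (xi_independent : mutually_independent P xi) :
  let success :=
    [set w : T | algorithm_returns eps (fun i => xi i w) [set: X]%SET] in
  measurable success /\ ((1 - eps)%:E < P success)%E.
Proof.
move=> success; pose n := #|X|.
pose I := [set` index_iota 2 n.+1].
pose F m := fewer_than xi (stop_time eps m) m.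
have inI m : I m = (2 <= m <= n)%N :> Prop by rewrite /I /= mem_index_iota ltnS.
have successE : success = ~` (\bigcup_(m in I) F m).
  apply/seteqP; split => w /=.
    move=> /(algorithm_returnsP _ eps_range _ X_nonempty) H [m].
    by rewrite inI /F /fewer_than /= => /H; rewrite leqNgt => /negP.
  move=> H; apply/(algorithm_returnsP _ eps_range _ X_nonempty) => m mn.
  by rewrite leqNgt; apply/negP => Fm; apply: H; exists m; rewrite ?inI.
have mF m : I m -> measurable (F m).
  by rewrite inI => mn; apply: measurable_fewer_than => //; lia.
have mU : measurable (\bigcup_(m in I) F m) by exact: bigcup_measurable.
split; first by rewrite successE; exact: measurableC.
rewrite successE probability_setC//.
suff : (P (\bigcup_(m in I) F m) < eps%:E)%E.
  rewrite -(fineK (fin_num_measure P _ mU)) lte_fin => h.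
  by rewrite -EFinB lte_fin; lra.
have [eps0 _] := andP eps_range.
have k1 := kappa1_ge1 _ eps_range.
pose G m : R := eps / kappa1 eps * expR (alpha eps * (m%:R * (ln m%:R - ln n%:R))).
apply: (@le_lt_trans _ _ (\sum_(2 <= m < n.+1) (G m)%:E)).
  apply: le_trans.
    apply: (content_sub_fsum P (D := I) (A_ := F)) => //.
    exact: finite_seq.
  rewrite -fsbig_seq ?iota_uniq//= big_seq [leRHS]big_seq.
  apply: lee_sum => m; rewrite mem_index_iota ltnS => mn.
  apply: le_trans (fewer_than_le _ _ _ _ _ _ _ _) _ => //; first by lia.
  rewrite lee_fin; apply: bin_mulXn_le_expR => //.
    by rewrite ltW// alpha_gt0.
  rewrite [leRHS]pmulrn (stop_timeE _ eps_range); last by lia.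
  exact: ceil_ge.
(* With [eps / kappa1] factored out, the strict bound of the exponential sum by [kappa1] remains. *)
rewrite sumEFin lte_fin /G -mulr_sumr -mulrA gtr_pMr//.
rewrite mulrC ltr_pdivrMr ?mul1r; last by lra.
exact: sum_expR_lt_kappa1.
Qed.
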